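(* Let $\mathbb{F}=\mathbb{Q}$. Let \begin{align*} R &= a_1 L^2({\ast}{\ast}{\ast}) + a_2 L(L({\ast}){\ast}{\ast}) + a_3 L^2({\ast}){\ast}{\ast} + a_4 L({\ast}L({\ast}){\ast}) + a_5 L({\ast}{\ast}L({\ast}))\\ &\quad + a_6 L({\ast})L({\ast}){\ast} + a_7 L({\ast}){\ast}L({\ast}) + a_8\,{\ast}L^2({\ast}){\ast} + a_9\,{\ast}L({\ast})L({\ast}) + a_{10}\,{\ast}{\ast}L^2({\ast}) \end{align*} be a nonzero operator polynomial of degree $3$ and multiplicity $2$ for a ternary associative operation, with coefficient vector $v=(a_1,\dots,a_{10})\in\mathbb{F}^{10}$. Assume that (i) the components of $v$ belong to the set $\{0,\pm1,\pm2\}$, and (ii) $v$ produces submaximal rank in the matrix of consequences, i.e. the rank of the matrix of consequences of $R$ is strictly smaller than the rank, over the function field $\mathbb{F}(a_1,\dots,a_{10})$, of the matrix of consequences of the generic operator polynomial with indeterminate coefficients $a_1,\dots,a_{10}$. Then $R$ is equivalent to (that is, is a nonzero scalar multiple of) an operator polynomial whose coefficient vector $(a_1,a_2,\dots,a_{10})$ is one of the following, for some values in $\mathbb{F}$ of the parameters $a_i$ occurring in it. Isolated points (9): - $(1,-2,1,2,-2,-2,2,1,-2,1)$ - $(1,-2,1,-2,-2,2,2,1,2,1)$ - $(1,-2,1,0,-2,0,2,0,0,1)$ - $(0,1,0,0,-1,0,0,0,0,0)$ - $(0,1,0,0,1,0,-1,0,0,0)$ - $(0,0,1,0,0,0,1,0,0,1)$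 - $(0,0,0,0,0,1,1,1,1,0)$ - $(0,0,0,0,0,1,-1,-1,1,0)$ - $(0,0,0,0,0,0,0,0,0,1)$ One-parameter families (27): - $(1,a_2,0,0,-1,0,-a_2,0,0,0)$ - $(1,-1,0,0,a_5,0,-a_5,0,0,0)$ - $(1,0,-1,0,0,0,0,a_8,0,-1)$ - $(1,0,0,a_4,0,0,0,0,0,0)$ - $(0,1,a_3,0,0,0,0,0,0,0)$ - $(0,1,-1,a_4,0,-a_4,0,0,0,0)$ - $(0,1,-1,0,a_5,0,-a_5,0,0,0)$ - $(0,1,0,a_4,0,-a_4,0,0,0,0)$ - $(0,1,0,a_4,0,0,0,0,0,0)$ - $(0,1,0,a_4,0,0,-1,0,-a_4,0)$ - $(0,1,0,0,0,0,a_7,0,0,0)$ - $(0,1,0,0,a_5,0,-1,0,0,-a_5)$ - $(0,0,1,0,0,0,a_7,0,0,0)$ - $(0,0,1,0,0,0,a_7,0,0,-a_7-1)$ - $(0,0,0,1,a_5,-1,-a_5,0,0,0)$ - $(0,0,0,1,a_5,0,0,0,0,0)$ - $(0,0,0,1,a_5,0,0,0,-1,0)$ - $(0,0,0,1,a_5,0,0,0,-1,-a_5)$ - $(0,0,0,1,0,a_6,0,0,0,0)$ - $(0,0,0,1,0,-1,0,a_8,-1,0)$ - $(0,0,0,1,0,0,0,0,a_9,0)$ - $(0,0,0,1,0,0,a_7,0,0,0)$ - $(0,0,0,0,1,0,a_7,0,0,0)$ - $(0,0,0,0,1,0,0,0,0,a_{10})$ - $(0,0,0,0,0,1,0,a_8,0,0)$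 - $(0,0,0,0,0,0,1,0,0,a_{10})$ - $(0,0,0,0,0,0,0,0,1,a_{10})$ Two-parameter families (6): - $(1,a_2,a_3,0,0,0,0,0,0,0)$ - $(1,a_2,-a_2-1,a_4,0,-a_4,0,0,0,0)$ - $(1,0,0,a_4,a_5,0,0,0,-a_4,-a_5-1)$ - $(1,0,0,0,a_5,0,0,0,0,a_{10})$ - $(0,0,1,0,0,a_6,0,a_8,0,0)$ - $(0,0,0,0,0,0,0,1,a_9,a_{10})$
   Context: **Associative triple systems.** An associative triple system over $\mathbb{F}$ is a vector space $A$ with a trilinear product $p\colon A^3\to A$ satisfying $p(p(a_1,a_2,a_3),a_4,a_5)=p(a_1,p(a_2,a_3,a_4),a_5)=p(a_1,a_2,p(a_3,a_4,a_5))$. The product is written by juxtaposition, $p(x,y,z)=xyz$; by associativity the value of any product of an odd number of factors is independent of the placement of the operation symbols. $L$ denotes a linear operator on the underlying vector space (no relation between $L$ and $p$ is assumed), and $L^2(M)$ means $L(L(M))$. **Operator monomials.** (Ternary) operator monomials are defined recursively: a single indeterminate is an operator monomial; if $M_1,M_2,M_3$ are operator monomials then so is $p(M_1,M_2,M_3)=M_1M_2M_3$; if $M$ is an operator monomial then so is $L(M)$. Operator monomials are identified modulo ternary associativity of $p$. The degree is the number of indeterminates, and the multiplicity is the number of occurrences of $L$. In a monomial of degree $d$ the indeterminates are always $x_1,\dots,x_d$ in this order from left to right (nonsymmetric setting), so each indeterminate is written as the generic argument symbol $\ast$. The ten operator monomials of degree 3 and multiplicity 2 are exactly those appearing in $R$.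 There are 140 operator monomials of degree 5 and multiplicity 3. **Operator polynomials.** An operator polynomial $R$ (or operator identity $R\equiv0$) of degree $d$ and multiplicity $m$ is a nonzero linear combination over $\mathbb{F}$ of the operator monomials of degree $d$ and multiplicity $m$. Two operator polynomials are equivalent if they differ only by a nonzero scalar multiple. **Partial composition.** Operator monomials and polynomials of degree $k$ are regarded as operations of arity $k$ (so $p$ has arity 3 and $L$ has arity 1). If $\alpha,\beta$ have arities $k,n$ and $1\le i\le k$, then $\alpha\circ_i\beta$ is the operation of arity $k+n-1$ obtained by substituting $\beta$ for the $i$-th argument of $\alpha$: $$\alpha\circ_i\beta=\alpha(x_1,\dots,x_{i-1},\beta(x_i,\dots,x_{i+n-1}),x_{i+n},\dots,x_{k+n-1}).$$ It is extended bilinearly to linear combinations. When $\alpha$ has arity 1 we write $\alpha\circ\beta$. **Consequences.** Let $R$ be an operator polynomial of degree $3$ and multiplicity $m$. Its consequences are the following operator polynomials of degree $5$ and multiplicity $m+1$, for all admissible values of the indices: - $(R\circ_i p)\circ_j L$ ($1\le i\le3$, $1\le j\le5$); - $L\circ(R\circ_i p)$ ($1\le i\le 3$); - $(p\circ_i R)\circ_j L$ ($1\le i\le3$, $1\le j\le5$); - $L\circ(p\circ_i R)$ ($1\le i\le3$); - $(R\circ_i L)\circ_j p$ ($1\le i,j\le3$); - $p\circ_j(R\circ_i L)$ ($1\le i,j\le3$); - $(L\circ R)\circ_i p$ ($1\le i\le3$); - $p\circ_i(L\circ R)$ ($1\le i\le3$). **Matrix of consequences.** Let $S_1,\dots,S_k$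 be the distinct consequences of $R$ (in any order) and let $m_1,\dots,m_\ell$ be all the operator monomials of degree $5$ and multiplicity $m+1$ (in a fixed total order; the choice of orders does not affect the rank). The matrix of consequences of $R$ is the $k\times\ell$ matrix whose $(i,j)$-entry is the coefficient of $m_j$ in $S_i$. For the generic $R$ of degree 3 and multiplicity 2, with indeterminate coefficients $a_1,\dots,a_{10}$, the matrix of consequences has size $42\times140$ and its rank over $\mathbb{F}(a_1,\dots,a_{10})$ is $42$, so submaximal rank means rank at most $41$. *)

(* Defs.v *)
From HB Require Import structures.
From mathcomp Require Import all_boot all_algebra.
From mathcomp Require Import freeg mpoly.
From mathcomp Require Import zify.

Set Implicit Arguments.
Unset Strict Implicit.
Unset Printing Implicit Defensive.

Import GRing.Theory.
Local Open Scope ring_scope.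

(* Operator monomials before identification modulo associativity.  [Arg] is
   the generic argument symbol (the indeterminates occur in the order
   x_1, ..., x_d, so their indices are not recorded). *)
Inductive tree := Arg | Prod of tree & tree & tree | Lop of tree.

Fixpoint degree (t : tree) : nat :=
  match t with
  | Arg => 1
  | Prod t1 t2 t3 => degree t1 + degree t2 + degree t3
  | Lop t1 => degree t1
  end.

Fixpoint multiplicity (t : tree) : nat :=
  match t with
  | Arg => 0
  | Prod t1 t2 t3 => multiplicity t1 + multiplicity t2 + multiplicity t3
  | Lop t1 => (multiplicity t1).+1
  end.

Inductive assoc_eq : tree -> tree -> Prop :=
| assoc_refl t : assoc_eq t t
| assoc_sym t u : assoc_eq t u -> assoc_eq u t
| assoc_trans t u v : assoc_eq t u -> assoc_eq u v -> assoc_eq t v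
| assoc_Prod t1 t2 t3 u1 u2 u3 :
    assoc_eq t1 u1 -> assoc_eq t2 u2 -> assoc_eq t3 u3 ->
    assoc_eq (Prod t1 t2 t3) (Prod u1 u2 u3)
| assoc_Lop t u : assoc_eq t u -> assoc_eq (Lop t) (Lop u)
| assoc_lm t1 t2 t3 t4 t5 :
    assoc_eq (Prod (Prod t1 t2 t3) t4 t5) (Prod t1 (Prod t2 t3 t4) t5)
| assoc_mr t1 t2 t3 t4 t5 :
    assoc_eq (Prod t1 (Prod t2 t3 t4) t5) (Prod t1 t2 (Prod t3 t4 t5)).

(* An operator monomial (a class of trees modulo associativity) is represented
   by its expression without product parentheses, a word in the letters
   [Star] = "*", [Open] = "L(", [Close] = ")".  Lemma [wordP] below states that
   two trees have the same word iff they agree modulo associativity. *)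
Inductive letter := Star | Open | Close.

Definition letter_code (c : letter) : option bool :=
  match c with Star => None | Open => Some true | Close => Some false end.
Definition letter_decode (o : option bool) : letter :=
  match o with None => Star | Some true => Open | Some false => Close end.
Lemma letter_codeK : cancel letter_code letter_decode.
Proof. by case. Qed.

HB.instance Definition _ := Countable.copy letter (can_type letter_codeK).

Notation word := (seq letter).

Fixpoint word_of (t : tree) : word :=
  match t with
  | Arg => [:: Star]
  | Prod t1 t2 t3 => word_of t1 ++ word_of t2 ++ word_of t3
  | Lop t1 => Open :: rcons (word_of t1) Close
  end.

Lemma word_of_assoc t u : assoc_eq t u -> word_of t = word_of u.
Proof. by elim=> //= *; rewrite -?catA; congruence. Qed.

Section WordP.

Local Notation "t =~ u" := (assoc_eq t u) (at level 70).

(* The right-combed product of an odd number of factors. *)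
Fixpoint comb_rec (t : tree) (l : seq tree) : tree :=
  match l with
  | t2 :: t3 :: l' => Prod t t2 (comb_rec t3 l')
  | _ => t
  end.
Definition comb (l : seq tree) := if l is t :: l' then comb_rec t l' else Arg.

(* The factors of the normal form of a tree. *)
Fixpoint factors (t : tree) : seq tree :=
  match t with
  | Arg => [:: Arg]
  | Prod t1 t2 t3 => factors t1 ++ factors t2 ++ factors t3
  | Lop t1 => [:: Lop (comb (factors t1))]
  end.

(* Recovers [factors t] from [word_of t], using a stack [k]. *)
Fixpoint parse (w : word) (cur : seq tree) (k : seq (seq tree)) : seq tree :=
  match w with
  | [::] => cur
  | Star :: w' => parse w' (rcons cur Arg) k
  | Open :: w' => parse w' [::] (cur :: k)
  | Close :: w' => parse w' (rcons (head [::] k) (Lop (comb cur))) (behead k)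
  end.

Lemma parse_word t w cur k :
  parse (word_of t ++ w) cur k = parse w (cur ++ factors t) k.
Proof.
elim: t w cur k => [|t1 IH1 t2 IH2 t3 IH3|t IH] w cur k /=.
- by rewrite cats1.
- by rewrite -!catA IH1 IH2 IH3 !catA.
- by rewrite cat_rcons IH /= cats1.
Qed.

Lemma factors_odd t : odd (size (factors t)).
Proof.
elim: t => //= t1 o1 t2 o2 t3 o3.
by rewrite !size_cat !oddD o1 o2 o3.
Qed.

Lemma comb_cat3 l1 l2 l3 :
  odd (size l1) -> odd (size l2) -> odd (size l3) ->
  Prod (comb l1) (comb l2) (comb l3) =~ comb (l1 ++ l2 ++ l3).
Proof.
have [n] := ubnP (size l1 + size l2).
elim: n l1 l2 => // n IH [|x [|y [|z l1]]] [|u [|v [|w l2]]] //= lt_n o1 o2 o3.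
- by case: l3 o3 lt_n {IH} => [|t l3] //= _ _; apply: assoc_refl.
- apply: assoc_trans (assoc_mr _ _ _ _ _) _.
  apply: assoc_Prod; [exact: assoc_refl..|].
  apply: (IH [:: v] (w :: l2)) => //=; first by lia.
  by rewrite /= !negbK in o2 *.
- apply: assoc_trans (assoc_lm _ _ _ _ _) _.
  apply: assoc_trans (assoc_mr _ _ _ _ _) _.
  apply: assoc_Prod; [exact: assoc_refl..|].
  apply: (IH (z :: l1) [:: u]) => //=; first by lia.
  by rewrite /= !negbK in o1 *.
- apply: assoc_trans (assoc_lm _ _ _ _ _) _.
  apply: assoc_trans (assoc_mr _ _ _ _ _) _.
  apply: assoc_Prod; [exact: assoc_refl..|].
  apply: (IH (z :: l1) [:: u, v, w & l2]) => //=; first by lia.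
  by rewrite /= !negbK in o1 *.
Qed.

Lemma comb_factors t : t =~ comb (factors t).
Proof.
elim: t => [|t1 IH1 t2 IH2 t3 IH3|t IH] /=; first exact: assoc_refl.
  apply: assoc_trans (assoc_Prod IH1 IH2 IH3) _.
  by apply: comb_cat3; apply: factors_odd.
exact: assoc_Lop.
Qed.

Lemma wordP t u : word_of t = word_of u <-> t =~ u.
Proof.
split=> [eq_w|]; last exact: word_of_assoc.
suff eq_f : factors t = factors u.
  apply: assoc_trans (comb_factors t) _; rewrite eq_f.
  exact/assoc_sym/comb_factors.
have := parse_word u [::] [::] [::].
by rewrite -eq_w parse_word.
Qed.

End WordP.

(* Substitution of [u] for the [i]-th argument (counted from 1) of [t]; nothing
   happens if [i] is 0 or larger than the degree of [t]. *)
Fixpoint tree_subst (i : nat) (t u : tree) : tree :=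
  match t with
  | Arg => if i == 1%N then u else Arg
  | Prod t1 t2 t3 =>
      Prod (tree_subst i t1 u)
           (tree_subst (i - degree t1) t2 u)
           (tree_subst (i - degree t1 - degree t2) t3 u)
  | Lop t1 => Lop (tree_subst i t1 u)
  end.

Fixpoint word_subst (i : nat) (w v : word) : word :=
  match w with
  | [::] => [::]
  | Star :: w' =>
      if i == 1%N then v ++ w' else Star :: word_subst i.-1 w' v
  | c :: w' => c :: word_subst i w' v
  end.

Lemma degreeE t : degree t = count_mem Star (word_of t).
Proof.
elim: t => [|t1 IH1 t2 IH2 t3 IH3|t IH] //=.
  by rewrite IH1 IH2 IH3 !count_cat addnA.
by rewrite IH -cats1 count_cat addn0.
Qed.

Lemma multiplicityE t : multiplicity t = count_mem Open (word_of t).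
Proof.
elim: t => [|t1 IH1 t2 IH2 t3 IH3|t IH] //=.
  by rewrite IH1 IH2 IH3 !count_cat addnA.
by rewrite IH -cats1 count_cat addn0.
Qed.

Lemma word_subst0 w v : word_subst 0 w v = w.
Proof. by elim: w => [|[] w IH] //=; rewrite IH. Qed.

Lemma word_subst_cat i w w' v :
  word_subst i (w ++ w') v =
    word_subst i w v ++ word_subst (i - count_mem Star w) w' v.
Proof.
elim: w i => [|[] w IH] i /=; rewrite ?subn0 ?IH //.
case: eqP => [->|_] /=; last by rewrite -subn1 subnDA.
by rewrite subnDA subnn sub0n word_subst0 catA.
Qed.

Lemma word_of_subst i t u :
  word_of (tree_subst i t u) = word_subst i (word_of t) (word_of u).
Proof.
elim: t i => [|t1 IH1 t2 IH2 t3 IH3|t IH] i /=; first by case: eqP; rewrite ?cats0.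
  by rewrite !word_subst_cat IH1 IH2 IH3 !degreeE.
by rewrite IH -!cats1 word_subst_cat.
Qed.

Definition splits (n : nat) : seq (nat * nat * nat) :=
  [seq (i, j, n - (i + j))%N | i <- iota 0 n.+1, j <- iota 0 (n - i).+1].

Definition words_prod (s1 s2 s3 : seq word) : seq word :=
  [seq w1 ++ w23 | w1 <- s1, w23 <- [seq w2 ++ w3 | w2 <- s2, w3 <- s3]].

(* The words of the trees of degree [d], multiplicity [m] and depth < [n]. *)
Fixpoint monomials_rec (n d m : nat) : seq word :=
  if n is n'.+1 then
    (if (d == 1%N) && (m == 0%N) then [:: [:: Star]] else [::])
    ++ (if m is m'.+1
        then [seq Open :: rcons w Close | w <- monomials_rec n' d m']
        else [::])
    ++ (if d is d'.+3
        then flatten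
          [seq words_prod (monomials_rec n' a.1.1.+1 b.1.1)
                          (monomials_rec n' a.1.2.+1 b.1.2)
                          (monomials_rec n' a.2.+1 b.2)
            | a <- splits d', b <- splits m]
        else [::])
  else [::].

Definition monomials (d m : nat) : seq word := undup (monomials_rec (d + m) d m).

Lemma mem_splits i j k n : ((i, j, k) \in splits n) = (i + j + k == n)%N.
Proof.
apply/allpairsPdep/eqP => [[i' [j' []]]|<-].
  by rewrite !mem_iota => ? ? [-> -> ->]; lia.
by exists i, j; rewrite !mem_iota; split; [lia..|congr (_, _, _); lia].
Qed.

Lemma monomials_rec_sound n d m w : w \in monomials_rec n d m ->
  exists t, [/\ word_of t = w, degree t = d & multiplicity t = m].
Proof.
elim: n d m w => // n IH d m w; rewrite !mem_cat => /or3P[].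
- case: ifP => // /andP[/eqP-> /eqP->]; rewrite inE => /eqP->.
  by exists Arg.
- case: m => // m /mapP[v /IH[t [<- <- <-]] ->].
  by exists (Lop t).
- case: d => [|[|[|d]]] // /flattenP[s /allpairsP[[[[a1 a2] a3] [[b1 b2] b3]] /=]].
  rewrite !mem_splits => -[/eqP da /eqP mb ->].
  case/allpairsP=> -[w1 w23] /= [/IH[t1 [<- d1 m1]] h23 ->].
  case/allpairsP: h23 => -[w2 w3] /= [/IH[t2 [<- d2 m2]] /IH[t3 [<- d3 m3]] ->].
  by exists (Prod t1 t2 t3) => /=; split=> //; lia.
Qed.

Lemma degree_gt0 t : (0 < degree t)%N.
Proof. by elim: t => //= t1 H1 t2 _ t3 _; lia. Qed.

Lemma monomials_rec_Prod n d1 d2 d3 m1 m2 m3 w1 w2 w3 :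
  w1 \in monomials_rec n d1.+1 m1 -> w2 \in monomials_rec n d2.+1 m2 ->
  w3 \in monomials_rec n d3.+1 m3 ->
  w1 ++ w2 ++ w3 \in monomials_rec n.+1 (d1 + d2 + d3).+3 (m1 + m2 + m3).
Proof.
move=> h1 h2 h3.
have in_tail (s1 s2 s3 : seq word) w : w \in s3 -> w \in s1 ++ s2 ++ s3.
  by rewrite !mem_cat => ->; rewrite !orbT.
apply: in_tail; apply/flattenP.
exists (words_prod (monomials_rec n d1.+1 m1) (monomials_rec n d2.+1 m2)
                   (monomials_rec n d3.+1 m3)); last by apply: allpairs_f => //; apply: allpairs_f.
apply/allpairsP; exists ((d1, d2, d3), (m1, m2, m3)).
by rewrite !mem_splits !eqxx.
Qed.

Lemma monomials_rec_complete n t :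
  (degree t + multiplicity t <= n)%N ->
  word_of t \in monomials_rec n (degree t) (multiplicity t).
Proof.
elim: n t => [|n IH] t; first by have := degree_gt0 t; case: degree.
case: t => [//|t1 t2 t3|t] le_n.
  have [] : [/\ 0 < degree t1, 0 < degree t2 & 0 < degree t3]%N.
    by split; apply: degree_gt0.
  move: le_n (IH t1) (IH t2) (IH t3); rewrite [degree _]/= [multiplicity _]/=.
  case: (degree t1) (degree t2) (degree t3) => [|d1] [|d2] [|d3] //.
  rewrite !(addSn, addnS) => le_n h1 h2 h3 _ _ _.
  by apply: monomials_rec_Prod; [apply: h1|apply: h2|apply: h3]; lia.
rewrite !mem_cat; apply/or3P; constructor 2.
by apply: map_f; apply: IH; move: le_n => /=; lia.
Qed.

Lemma mem_monomials d m w :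
  w \in monomials d m <->
  exists t, [/\ word_of t = w, degree t = d & multiplicity t = m].
Proof.
rewrite mem_undup; split=> [/monomials_rec_sound //|[t [<- <- <-]]].
exact: monomials_rec_complete.
Qed.

Lemma monomials_uniq d m : uniq (monomials d m).
Proof. exact: undup_uniq. Qed.

Section OperatorPolynomials.

Variable K : fieldType.

(* Formal linear combinations of words. *)
Notation opoly := {freeg word / K}.

Definition monom (t : tree) : opoly := << word_of t >>.

Definition opL : opoly := monom (Lop Arg).
Definition opp3 : opoly := monom (Prod Arg Arg Arg).

Definition pcomp (i : nat) (f g : opoly) : opoly :=
  fglift (fun w => fglift (fun v => << word_subst i w v >> : opoly) g) f.

Local Notation "f \o_[ i ] g" := (pcomp i f g)
  (at level 50, left associativity).
Local Notation L := opL.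
Local Notation p := opp3.

Definition consequences (R : opoly) : seq opoly :=
     [seq (R \o_[i] p) \o_[j] L | i <- iota 1 3, j <- iota 1 5]
  ++ [seq L \o_[1] (R \o_[i] p) | i <- iota 1 3]
  ++ [seq (p \o_[i] R) \o_[j] L | i <- iota 1 3, j <- iota 1 5]
  ++ [seq L \o_[1] (p \o_[i] R) | i <- iota 1 3]
  ++ [seq (R \o_[i] L) \o_[j] p | i <- iota 1 3, j <- iota 1 3]
  ++ [seq p \o_[j] (R \o_[i] L) | i <- iota 1 3, j <- iota 1 3]
  ++ [seq (L \o_[1] R) \o_[i] p | i <- iota 1 3]
  ++ [seq p \o_[i] (L \o_[1] R) | i <- iota 1 3].

Definition conseq_mx (m : nat) (R : opoly) :
    'M[K]_(size (undup (consequences R)), size (monomials 5 m.+1)) :=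
  \matrix_(i, j) coeff (nth [::] (monomials 5 m.+1) j)
                       (nth 0 (undup (consequences R)) i).

Definition op_equiv (f g : opoly) : Prop := exists2 c : K, c != 0 & f = c *: g.

(* With indices shifted by one: [a`_k] is the coefficient a_(k+1). *)
Definition opoly32 (a : 10.-tuple K) : opoly :=
  let x := Arg in
    a`_0 *: monom (Lop (Lop (Prod x x x)))
  + a`_1 *: monom (Lop (Prod (Lop x) x x))
  + a`_2 *: monom (Prod (Lop (Lop x)) x x)
  + a`_3 *: monom (Lop (Prod x (Lop x) x))
  + a`_4 *: monom (Lop (Prod x x (Lop x)))
  + a`_5 *: monom (Prod (Lop x) (Lop x) x)
  + a`_6 *: monom (Prod (Lop x) x (Lop x))
  + a`_7 *: monom (Prod x (Lop (Lop x)) x)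
  + a`_8 *: monom (Prod x (Lop x) (Lop x))
  + a`_9 *: monom (Prod x x (Lop (Lop x))).

End OperatorPolynomials.

Definition generic_coeffs : 10.-tuple {fraction {mpoly rat[10]}} :=
  [tuple tofrac ('X_i : {mpoly rat[10]}) | i < 10].

Inductive listed : 10.-tuple rat -> Prop :=
| pt1 : listed [tuple 1; -2; 1; 2; -2; -2; 2; 1; -2; 1]
| pt2 : listed [tuple 1; -2; 1; -2; -2; 2; 2; 1; 2; 1]
| pt3 : listed [tuple 1; -2; 1; 0; -2; 0; 2; 0; 0; 1]
| pt4 : listed [tuple 0; 1; 0; 0; -1; 0; 0; 0; 0; 0]
| pt5 : listed [tuple 0; 1; 0; 0; 1; 0; -1; 0; 0; 0]
| pt6 : listed [tuple 0; 0; 1; 0; 0; 0; 1; 0; 0; 1]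
| pt7 : listed [tuple 0; 0; 0; 0; 0; 1; 1; 1; 1; 0]
| pt8 : listed [tuple 0; 0; 0; 0; 0; 1; -1; -1; 1; 0]
| pt9 : listed [tuple 0; 0; 0; 0; 0; 0; 0; 0; 0; 1]
| line1 a2 : listed [tuple 1; a2; 0; 0; -1; 0; -a2; 0; 0; 0]
| line2 a5 : listed [tuple 1; -1; 0; 0; a5; 0; -a5; 0; 0; 0]
| line3 a8 : listed [tuple 1; 0; -1; 0; 0; 0; 0; a8; 0; -1]
| line4 a4 : listed [tuple 1; 0; 0; a4; 0; 0; 0; 0; 0; 0]
| line5 a3 : listed [tuple 0; 1; a3; 0; 0; 0; 0; 0; 0; 0]
| line6 a4 : listed [tuple 0; 1; -1; a4; 0; -a4; 0; 0; 0; 0]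
| line7 a5 : listed [tuple 0; 1; -1; 0; a5; 0; -a5; 0; 0; 0]
| line8 a4 : listed [tuple 0; 1; 0; a4; 0; -a4; 0; 0; 0; 0]
| line9 a4 : listed [tuple 0; 1; 0; a4; 0; 0; 0; 0; 0; 0]
| line10 a4 : listed [tuple 0; 1; 0; a4; 0; 0; -1; 0; -a4; 0]
| line11 a7 : listed [tuple 0; 1; 0; 0; 0; 0; a7; 0; 0; 0]
| line12 a5 : listed [tuple 0; 1; 0; 0; a5; 0; -1; 0; 0; -a5]
| line13 a7 : listed [tuple 0; 0; 1; 0; 0; 0; a7; 0; 0; 0]
| line14 a7 : listed [tuple 0; 0; 1; 0; 0; 0; a7; 0; 0; -a7 - 1]
| line15 a5 : listed [tuple 0; 0; 0; 1; a5; -1; -a5; 0; 0; 0]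
| line16 a5 : listed [tuple 0; 0; 0; 1; a5; 0; 0; 0; 0; 0]
| line17 a5 : listed [tuple 0; 0; 0; 1; a5; 0; 0; 0; -1; 0]
| line18 a5 : listed [tuple 0; 0; 0; 1; a5; 0; 0; 0; -1; -a5]
| line19 a6 : listed [tuple 0; 0; 0; 1; 0; a6; 0; 0; 0; 0]
| line20 a8 : listed [tuple 0; 0; 0; 1; 0; -1; 0; a8; -1; 0]
| line21 a9 : listed [tuple 0; 0; 0; 1; 0; 0; 0; 0; a9; 0]
| line22 a7 : listed [tuple 0; 0; 0; 1; 0; 0; a7; 0; 0; 0]
| line23 a7 : listed [tuple 0; 0; 0; 0; 1; 0; a7; 0; 0; 0]
| line24 a10 : listed [tuple 0; 0; 0; 0; 1; 0; 0; 0; 0; a10]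
| line25 a8 : listed [tuple 0; 0; 0; 0; 0; 1; 0; a8; 0; 0]
| line26 a10 : listed [tuple 0; 0; 0; 0; 0; 0; 1; 0; 0; a10]
| line27 a10 : listed [tuple 0; 0; 0; 0; 0; 0; 0; 0; 1; a10]
| plane1 a2 a3 : listed [tuple 1; a2; a3; 0; 0; 0; 0; 0; 0; 0]
| plane2 a2 a4 : listed [tuple 1; a2; -a2 - 1; a4; 0; -a4; 0; 0; 0; 0]
| plane3 a4 a5 : listed [tuple 1; 0; 0; a4; a5; 0; 0; 0; -a4; -a5 - 1]
| plane4 a5 a10 : listed [tuple 1; 0; 0; 0; a5; 0; 0; 0; 0; a10]
| plane5 a6 a8 : listed [tuple 0; 0; 1; 0; 0; a6; 0; a8; 0; 0]
| plane6 a9 a10 : listed [tuple 0; 0; 0; 0; 0; 0; 0; 1; a9; a10].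

(* Main.v *)
From HB Require Import structures.
From Stdlib Require Import ZArith.
From mathcomp Require Import all_boot all_algebra.
From mathcomp Require Import freeg mpoly.
From mathcomp Require Import ssrZ ring.
Require Import Defs.

Set Implicit Arguments.
Unset Strict Implicit.
Unset Printing Implicit Defensive.

Import GRing.Theory Num.Theory.
Local Open Scope ring_scope.

(** Composing [R] with monomials leaves its coefficients in place: every
    consequence of [R] has the form [sum_k a_k w_k], where the ten words [w_k]
    do not depend on the coefficient vector [a] ([consequencesE]).  The sixty
    consequences give only 42 different lists of words, so the generic rank is
    at most 42 ([rank_conseq_le]), and submaximal rank forces a nonzero vector
    [y] of 42 rationals such that [sum_r y_r S_r] vanishes, [S_r] being the
    consequence attached to the [r]-th list ([relation_of_rank]).

    Comparing coefficients turns this relation into 140 equations, one for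
    each monomial of degree 5 and multiplicity 3.  Within one consequence a
    monomial occurs at most once, so each equation is a sum of two to five
    products [a_k y_r] ([nontrivial_relation]).  For given [a] this is a
    linear system in [y], and the claim is that a vector [a] with entries in
    {0, 1, -1, 2, -2} for which it has a nonzero solution is a multiple of a
    listed vector.

    The case analysis over [a] has two stages.  The first one only decides
    which [a_k] vanish.  As soon as a single product [a_k y_r] with
    [a_k != 0] survives in an equation, [y_r = 0], and this may leave a single
    product in further equations.  This already gives [y = 0] except for 75 of
    the 1024 possible supports of [a] (one of the 75 is empty).  In the second
    stage the nonzero [a_k] receive their values [1], [-1], [2], [-2] one after
    the other, and each equation all of whose coefficients are known cuts down
    the space of candidates for [y].  A branch is closed when this space is
    zero.  There remain the zero vector and 992 nonzero vectors, each of which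
    is compared with the listed families after division by its first nonzero
    entry.

    The search is a computation on exact integers ([search_listed]); that it
    misses nothing is proved for an arbitrary system of equations and an
    arbitrary test on the leaves ([searchP]). *)

(** * Consequences as lists of words *)

Definition word_L : word := word_of (Lop Arg).
Definition word_p : word := word_of (Prod Arg Arg Arg).

(** The words of the ten monomials, in the order of the coefficients
    [a_1, ..., a_10]. *)
Definition words32 : seq word :=
  let x := Arg in
  map word_of [:: Lop (Lop (Prod x x x)); Lop (Prod (Lop x) x x);
    Prod (Lop (Lop x)) x x; Lop (Prod x (Lop x) x); Lop (Prod x x (Lop x));
    Prod (Lop x) (Lop x) x; Prod (Lop x) x (Lop x); Prod x (Lop (Lop x)) x;
    Prod x (Lop x) (Lop x); Prod x x (Lop (Lop x))].

Definition subst_in (i : nat) (ws : seq word) (v : word) : seq word :=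
  [seq word_subst i w v | w <- ws].
Definition subst_into (i : nat) (v : word) (ws : seq word) : seq word :=
  [seq word_subst i v w | w <- ws].

(** The same shape as [consequences], with the words of the monomials of [R] in
    place of [R]; the [k]-th word of a row is the one that carries [a_(k+1)]. *)
Definition all_rows : seq (seq word) :=
  let R := words32 in let p := word_p in let L := word_L in
     [seq subst_in j (subst_in i R p) L | i <- iota 1 3, j <- iota 1 5]
  ++ [seq subst_into 1 L (subst_in i R p) | i <- iota 1 3]
  ++ [seq subst_in j (subst_into i p R) L | i <- iota 1 3, j <- iota 1 5]
  ++ [seq subst_into 1 L (subst_into i p R) | i <- iota 1 3]
  ++ [seq subst_in j (subst_in i R L) p | i <- iota 1 3, j <- iota 1 3]
  ++ [seq subst_into j p (subst_in i R L) | i <- iota 1 3, j <- iota 1 3]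
  ++ [seq subst_in i (subst_into 1 L R) p | i <- iota 1 3]
  ++ [seq subst_into i p (subst_into 1 L R) | i <- iota 1 3].

Definition rows : seq (seq word) := undup all_rows.

Lemma size_rows : size rows = 42%N.
Proof. by vm_compute. Qed.

Section LinearCombinations.
Variable K : fieldType.
Implicit Types (s : seq K) (ws : seq word) (v w : word) (f g : {freeg word / K}).

HB.instance Definition _ (M : lmodType K) (h : word -> M) :=
  GRing.isAdditive.Build {freeg word / K} M (fglift h) (lift_is_additive h).

Definition lincomb s ws : {freeg word / K} :=
  \sum_(0 <= k < size ws) << s`_k *g nth [::] ws k >>.

Lemma scale_freegU (c k : K) (w : word) :
  c *: << k *g w >> = << c * k *g w >> :> {freeg word / K}.
Proof. by apply/eqP/freeg_eqP=> x; rewrite coeffZ !coeffU mulrA. Qed.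

Lemma fglift_lincomb (M : lmodType K) (h : word -> M) s ws :
  fglift h (lincomb s ws) = \sum_(0 <= k < size ws) s`_k *: h (nth [::] ws k).
Proof. by rewrite raddf_sum; apply: eq_bigr => k _; rewrite /= liftU. Qed.

Lemma lincomb_map s ws (h : word -> word) :
  lincomb s (map h ws) = \sum_(0 <= k < size ws) << s`_k *g h (nth [::] ws k) >>.
Proof.
rewrite /lincomb size_map; apply: eq_big_nat => k /andP[_ lt_k].
by rewrite (nth_map [::]).
Qed.

Lemma coeff_lincomb s ws w :
  coeff w (lincomb s ws) =
    \sum_(0 <= k < size ws) s`_k * (nth [::] ws k == w)%:R.
Proof. by rewrite raddf_sum; apply: eq_bigr => k _; rewrite /= coeffU. Qed.

Lemma lincombZ c s ws : lincomb [seq c * x | x <- s] ws = c *: lincomb s ws.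
Proof.
rewrite scaler_sumr; apply: eq_bigr => k _; rewrite scale_freegU.
have [lt_k|le_k] := ltnP k (size s); first by rewrite (nth_map 0).
by rewrite (nth_default _ le_k) nth_default ?size_map // mulr0.
Qed.

Lemma pcomp_lincomb_monom i s ws t :
  pcomp i (lincomb s ws) (monom K t) = lincomb s (subst_in i ws (word_of t)).
Proof.
rewrite /pcomp fglift_lincomb lincomb_map; apply: eq_bigr => k _.
by rewrite liftU scale1r scale_freegU mulr1.
Qed.

Lemma pcomp_monom_lincomb i t s ws :
  pcomp i (monom K t) (lincomb s ws) = lincomb s (subst_into i (word_of t) ws).
Proof.
rewrite /pcomp liftU scale1r fglift_lincomb lincomb_map.
by apply: eq_bigr => k _; rewrite scale_freegU mulr1.
Qed.

Lemma opoly32E (a : 10.-tuple K) : opoly32 a = lincomb a words32.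
Proof.
rewrite /lincomb big_mkord !big_ord_recl big_ord0 /= !addrA addr0.
by rewrite /opoly32 /monom !scale_freegU !mulr1.
Qed.

(** Composition is bilinear and every factor other than [R] is a monomial, so the
    coefficients of [R] are carried along unchanged. *)
Lemma consequencesE (a : 10.-tuple K) :
  consequences (opoly32 a) = map (lincomb a) all_rows.
Proof.
rewrite opoly32E /consequences /all_rows; cbv zeta.
do ?[rewrite [RHS]map_cat; congr (_ ++ _)] => //;
  rewrite -[RHS]map_comp; apply: eq_map => i /=;
  by rewrite !(pcomp_lincomb_monom, pcomp_monom_lincomb).
Qed.

(** * Relations among the consequences *)

(** Equal lists of words give equal consequences, so the matrix has at most 42
    rows. *)
Lemma rank_conseq_le (a : 10.-tuple K) :
  (\rank (conseq_mx 2 (opoly32 a)) <= 42)%N.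
Proof.
apply: leq_trans (rank_leq_row _) _.
suff: (size (undup (consequences (opoly32 a))) <= size (map (lincomb a) rows))%N.
  by rewrite size_map size_rows.
apply: uniq_leq_size (undup_uniq _) _ => x; rewrite mem_undup consequencesE.
by case/mapP=> ws; rewrite -mem_undup => ws_row ->; apply: map_f.
Qed.

(** The vectors [x r] may repeat each other: a matrix with [n] rows, all taken from
    a matrix of rank less than [n], has dependent rows.  Hence coincidences
    among the 42 consequences for special coefficients need no separate
    treatment. *)
Lemma relation_of_rank_lt (S : seq {freeg word / K}) (ms : seq word) n
    (x : 'I_n -> {freeg word / K}) :
    (forall r, x r \in S) ->
    (\rank (\matrix_(i < size S, j < size ms)
               coeff (nth [::] ms j) (nth 0%R S i))%R < n)%N ->
  exists2 y : 'rV[K]_n, y != 0 &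
    forall w, w \in ms -> \sum_r y 0 r * coeff w (x r) = 0.
Proof.
move=> x_S rank_lt; set A := (X in \rank X) in rank_lt.
pose M := \matrix_(r < n, j < size ms) coeff (nth [::] ms j) (x r).
have M_sub : (M <= A)%MS.
  apply/row_subP => r; have lt_r := x_S r; rewrite -index_mem in lt_r.
  suff -> : row r M = row (Ordinal lt_r) A by exact: row_sub.
  by apply/rowP => j; rewrite !mxE /= nth_index.
have: kermx M != 0.
  by rewrite -mxrank_eq0 mxrank_ker subn_eq0 -ltnNge (leq_ltn_trans (mxrankS M_sub)).
case/rowV0Pn=> y /sub_kermxP yM0 y_neq0; exists y => // w w_ms.
have lt_w := w_ms; rewrite -index_mem in lt_w.
have /rowP/(_ (Ordinal lt_w)) := yM0; rewrite !mxE => sum0.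
by rewrite -[RHS]sum0; apply: eq_bigr => r _; rewrite mxE /= nth_index.
Qed.

Lemma relation_of_rank (a : 10.-tuple K) :
    (\rank (conseq_mx 2 (opoly32 a)) < 42)%N ->
  exists2 y : 'rV[K]_42, y != 0 &
    forall w, w \in monomials 5 3 ->
      \sum_r y 0 r * coeff w (lincomb a (nth [::] rows r)) = 0.
Proof.
apply: relation_of_rank_lt => r.
rewrite mem_undup consequencesE map_f // -mem_undup -/rows.
by apply: mem_nth; rewrite size_rows.
Qed.

End LinearCombinations.

(** * Sparse integer vectors and the spaces that they span *)

(** A sparse vector indexed by [nat]; the first entry for an index counts. *)
Definition svec := seq (nat * Z).

Fixpoint coef (b : svec) (r : nat) : Z :=
  if b is (s, z) :: b' then if r == s then z else coef b' r else Z0.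

Definition nonzero (z : Z) : bool := if z is Z0 then false else true.

Definition pairing (f b : svec) : Z :=
  foldr (fun e => Z.add (Z.mul e.2 (coef b e.1))) Z0 f.

Definition combine (u : Z) (b : svec) (u' : Z) (b' : svec) : svec :=
  [seq e <- [seq (r, Z.sub (Z.mul u (coef b r)) (Z.mul u' (coef b' r)))
     | r <- undup (unzip1 b ++ unzip1 b')] | nonzero e.2].

(** A combination of [b] and [b0] on which [f] vanishes, given that [f] takes
    the value [v0 != 0] at [b0].  Dividing both multipliers by their gcd keeps
    the entries of all vectors of the search below small. *)
Definition eliminate (f : svec) (v0 : Z) (b0 b : svec) : svec :=
  let v := pairing f b in
  if nonzero v then let: (_, (u0, u)) := Z.ggcd v0 v in combine u0 b u b0
  else b.

(** A spanning family of the subspace of the span of [B] on which [f] vanishes. *)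
Fixpoint cut (f : svec) (B : seq svec) : seq svec :=
  if B is b :: B' then
    let v := pairing f b in
    if nonzero v then map (eliminate f v b) B' else b :: cut f B'
  else [::].

Definition Zrat (z : Z) : rat := (int_of_Z z)%:~R.

Lemma ZratB x y : Zrat (Z.sub x y) = Zrat x - Zrat y.
Proof. by rewrite /Zrat (rmorphB int_of_Z x y) rmorphB. Qed.
Lemma ZratM x y : Zrat (Z.mul x y) = Zrat x * Zrat y.
Proof. by rewrite /Zrat (rmorphM int_of_Z x y) rmorphM. Qed.
Lemma ZratD x y : Zrat (Z.add x y) = Zrat x + Zrat y.
Proof. by rewrite /Zrat (rmorphD int_of_Z x y) rmorphD. Qed.

Lemma Zrat_eq0 z : (Zrat z == 0) = ~~ nonzero z.
Proof.
rewrite /Zrat intr_eq0 -(rmorph0 int_of_Z) (inj_eq (can_inj int_of_ZK)).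
by case: z.
Qed.

Lemma Zrat_neq0 z : (Zrat z != 0) = nonzero z.
Proof. by rewrite Zrat_eq0 negbK. Qed.

Implicit Types (f b : svec) (B : seq svec) (y : nat -> rat).

Definition eval f y : rat := \sum_(e <- f) Zrat e.2 * y e.1.

Definition vect b : nat -> rat := fun r => Zrat (coef b r).

Lemma eval_vect f b : eval f (vect b) = Zrat (pairing f b).
Proof.
rewrite /eval /pairing; elim: f => [|e f IH]; first by rewrite big_nil.
by rewrite big_cons IH /= ZratD ZratM.
Qed.

Lemma evalB f y c x : eval f (fun r => y r - c * x r) = eval f y - c * eval f x.
Proof. by rewrite /eval mulr_sumr -sumrB; apply: eq_bigr => e _; ring. Qed.

Lemma coef_tabulate (h : nat -> Z) (s : seq nat) r :
  coef [seq e <- [seq (r, h r) | r <- s] | nonzero e.2] r =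
    if r \in s then h r else Z0.
Proof.
elim: s => //= t s IH; rewrite in_cons.
case: (boolP (nonzero (h t))) => /= [_|]; rewrite IH; first by case: eqP => [->|].
by case: eqP => //= ->; case: ifP; case: (h t).
Qed.

Lemma coef_notin b r : r \notin unzip1 b -> coef b r = Z0.
Proof. by elim: b => //= -[s z] b IH; rewrite in_cons; case: eqP. Qed.

Lemma vect_combine u b u' b' r :
  vect (combine u b u' b') r = Zrat u * vect b r - Zrat u' * vect b' r.
Proof.
rewrite /vect /combine coef_tabulate mem_undup mem_cat -!ZratM -ZratB.
case: ifPn => //; rewrite negb_or => /andP[rb rb'].
by rewrite !coef_notin // !Z.mul_0_r.
Qed.

(** [y] is a rational combination of the vectors of [B].  Peeling off one vector
    at a time is the form in which [cut] processes [B]. *)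
Fixpoint spanned B y : Prop :=
  if B is b :: B' then exists c, spanned B' (fun r => y r - c * vect b r)
  else y =1 fun=> 0.

Lemma eq_spanned B y y' : y =1 y' -> spanned B y -> spanned B y'.
Proof.
elim: B y y' => [|b B IH] y y' eq_y /=; first by move=> y0 r; rewrite -eq_y.
by case=> c yB; exists c; apply: IH yB => r; rewrite eq_y.
Qed.

Lemma eval_spanned f B y :
  spanned B y -> all (fun b => ~~ nonzero (pairing f b)) B -> eval f y = 0.
Proof.
elim: B y => [|b B IH] y /=.
  by move=> y0 _; rewrite /eval big1 // => e _; rewrite y0 mulr0.
case=> c /IH{}IH /andP[fb0 /IH]; rewrite evalB eval_vect.
by rewrite -Zrat_eq0 in fb0; rewrite (eqP fb0) mulr0 subr0.
Qed.

(** Only these three facts about the multipliers matter; they cover the case in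
    which [b] is left alone as well. *)
Lemma eliminateP f v0 b0 b : nonzero v0 -> exists c d,
  [/\ c != 0, vect (eliminate f v0 b0 b) =1 (fun r => c * vect b r - d * vect b0 r)
    & c * Zrat (pairing f b) = d * Zrat v0].
Proof.
move=> v0_neq0; rewrite /eliminate; case: ifPn => [_|fb0].
  have := Z.ggcd_correct_divisors v0 (pairing f b).
  case: Z.ggcd => g [u0 u] [def_v0 def_v]; exists (Zrat u0), (Zrat u).
  split=> [||]; last by rewrite def_v def_v0 !ZratM; ring.
    by move: v0_neq0; rewrite -!Zrat_neq0 def_v0 ZratM mulf_eq0 negb_or => /andP[].
  by move=> r; rewrite vect_combine.
exists 1, 0; split=> // [r|]; first by rewrite mul1r mul0r subr0.
by rewrite -Zrat_eq0 in fb0; rewrite (eqP fb0) mulr0 mul0r.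
Qed.

Lemma pairing_eliminate f b0 b : nonzero (pairing f b0) ->
  ~~ nonzero (pairing f (eliminate f (pairing f b0) b0 b)).
Proof.
move=> fb0; have [c [d [_ eq_b eq_f]]] := eliminateP f b0 b fb0.
rewrite -Zrat_eq0 -eval_vect.
have -> : eval f (vect (eliminate f (pairing f b0) b0 b)) =
          c * eval f (vect b) - d * eval f (vect b0).
  by rewrite /eval !mulr_sumr -sumrB; apply: eq_bigr => e _; rewrite eq_b; ring.
by rewrite !eval_vect eq_f subrr.
Qed.

Lemma spanned_eliminate f v0 b0 B y : nonzero v0 -> spanned B y ->
  exists c, spanned (map (eliminate f v0 b0) B) (fun r => y r - c * vect b0 r).
Proof.
move=> v0_neq0; elim: B y => [|b B IH] y /=.
  by move=> y0; exists 0 => r; rewrite y0 mul0r subr0.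
case=> c /IH[d yB]; have [u0 [u [u0_neq0 eq_b _]]] := eliminateP f b0 b v0_neq0.
exists (d + c * u / u0), (c / u0); apply: eq_spanned yB => r; rewrite eq_b.
by field.
Qed.

(** If [f b != 0], then [y] lies in the span of the eliminated vectors up to a
    multiple of [b]; as [f] vanishes at [y] and at all these vectors, the multiple
    is zero. *)
Lemma cutP f B y : spanned B y -> eval f y = 0 -> spanned (cut f B) y.
Proof.
elim: B y => [|b B IH] y //= [c yB] fy0; case: ifPn => fb.
  have [d yB'] := spanned_eliminate f b fb yB.
  have cd0 : (c + d) * Zrat (pairing f b) = 0.
    transitivity (- eval f (fun r => y r - c * vect b r - d * vect b r)).
      by rewrite !evalB fy0 eval_vect; ring.
    rewrite (eval_spanned yB') ?oppr0 // all_map.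
    by apply/allP => b' _; apply: pairing_eliminate.
  apply: eq_spanned yB' => r; rewrite -addrA -opprD -mulrDl.
  by move/eqP: cd0; rewrite mulf_eq0 Zrat_eq0 fb orbF => /eqP->; rewrite mul0r subr0.
exists c; apply: IH => //; rewrite evalB fy0 eval_vect.
by rewrite -Zrat_eq0 in fb; rewrite (eqP fb) mulr0 subr0.
Qed.

Definition unit_vectors (n : nat) : seq svec := [seq [:: (r, Zpos xH)] | r <- iota 0 n].

Lemma spanned_unit_vectors n y :
  (forall r, (n <= r)%N -> y r = 0) -> spanned (unit_vectors n) y.
Proof.
rewrite /unit_vectors => y0.
suff: forall m, (forall r, (r < m)%N || (m + n <= r)%N -> y r = 0) ->
    spanned [seq [:: (r, Zpos xH)] | r <- iota m n] y by apply.
elim: n y {y0} => [|n IH] y m y0 /=.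
  by move=> r; apply: y0; rewrite addn0; case: ltnP.
exists (y m); apply: IH => r; rewrite /vect /= addSnnS ltnS leq_eqVlt => yr.
have [->|r_neq] := eqVneq r m; first by rewrite mulr1 subrr.
by rewrite mulr0 subr0 y0 //; move: yr; rewrite (negbTE r_neq).
Qed.

(** * The case analysis *)

(** What a branch of the case analysis has fixed about one coefficient. *)
Variant knowledge := Unknown | Nonzero | Value of Z.

Definition known (env : seq knowledge) (k : nat) := nth Unknown env k.

(** The flags of the indices at which some vector of [B] may be nonzero: at all
    other indices [y] vanishes. *)
Definition support (B : seq svec) : seq bool :=
  foldr (fun r s => set_nth false s r true) [::] (flatten (map unzip1 B)).

Definition is_value (kn : knowledge) := if kn is Value _ then true else false.

(** An equation is a list of pairs [(r, k)], each standing for the product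
    [a_k y_r]; a product that is known to vanish is irrelevant. *)
Definition relevant (supp : seq bool) (env : seq knowledge) (e : nat * nat) :=
  nth false supp e.1 && (if known env e.2 is Value Z0 then false else true).

(** A sum of products constrains [y] linearly if all coefficients have known
    values, but a product standing alone does so as soon as its coefficient is
    known to be nonzero. *)
Definition usable (env : seq knowledge) (c : seq (nat * nat)) : bool :=
  match c with
  | [:: e] => if known env e.2 is Unknown then false else true
  | _ => all (fun e => is_value (known env e.2)) c
  end.

(** The default value 1 is meant for a product standing alone, where any nonzero
    coefficient gives the same condition. *)
Definition form (env : seq knowledge) (c : seq (nat * nat)) : svec :=
  [seq (e.1, if known env e.2 is Value z then z else Zpos xH) | e <- c].

(** One pass over the equations: usable ones are imposed on [B] and dropped, the
    others are kept with their relevant terms only. *)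
Fixpoint sweep (supp : seq bool) env cols B : seq (seq (nat * nat)) * seq svec :=
  if cols is c :: cols' then
    let c' := filter (relevant supp env) c in
    if nilp c' then sweep supp env cols' B else
    if usable env c' then sweep supp env cols' (cut (form env c') B)
    else let: (rest, B') := sweep supp env cols' B in (c' :: rest, B')
  else ([::], B).

(** When [B] has shrunk, more products may vanish, and so more equations may have
    become usable. *)
Fixpoint propagate n env cols B : seq (seq (nat * nat)) * seq svec :=
  let: (cols', B') := sweep (support B) env cols B in
  if n is n'.+1 then
    if (size B' < size B)%nat then propagate n' env cols' B' else (cols', B')
  else (cols', B').

(** One step of the case distinction on a coefficient; a coefficient that is not
    zero takes two steps, one for each stage. *)
Definition refine (kn : knowledge) : seq knowledge :=
  match kn with
  | Unknown => [:: Value Z0; Nonzero]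
  | Nonzero => [seq Value z | z <- [:: 1; -1; 2; -2] : seq Z]
  | Value z => [:: Value z]
  end.

(** A variable occurring twice in [vars] goes through both stages.  The inner
    conditional is not written with [||], since a strict evaluation would then
    explore closed branches as well. *)
Fixpoint search (P : seq knowledge -> bool) vars env cols B : bool :=
  if vars is k :: vars' then
    if is_value (known env k) then search P vars' env cols B else
    all (fun kn => let env' := set_nth Unknown env k kn in
           let: (cols', B') := propagate (size B) env' cols B in
           if nilp B' then true else search P vars' env' cols' B')
      (refine (known env k))
  else P env.

Implicit Types (env : seq knowledge) (a : nat -> rat) (c : seq (nat * nat)).

Definition agrees (kn : knowledge) (x : rat) : Prop :=
  match kn with
  | Unknown => True
  | Nonzero => x != 0
  | Value z => x = Zrat z
  end.

Definition compatible env a := forall k, agrees (known env k) (a k).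

Definition equation a y c : Prop := \sum_(e <- c) a e.2 * y e.1 = 0.

Definition small_values : seq rat := [:: 0; 1; -1; 2; -2].

Lemma refineP kn x : x \in small_values -> agrees kn x ->
  exists n, (n < size (refine kn))%N /\ agrees (nth Unknown (refine kn) n) x.
Proof.
have Z0E : 0 = Zrat Z0 by [].
case: kn => [|| z] /= x_small; last by exists 0%N.
  by move=> _; have [->|x_neq0] := eqVneq x 0; [exists 0%N | exists 1%N].
by move: x_small; rewrite inE => /predU1P[->|]; rewrite ?eqxx // => + _;
  rewrite !inE => /or4P[] /eqP->; [exists 0%N|exists 1%N|exists 2%N|exists 3%N].
Qed.

Lemma nth_support B r b : ~~ nth false (support B) r -> b \in B -> coef b r = Z0.
Proof.
move=> r_supp bB; apply: coef_notin; apply: contra r_supp => rb.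
have: r \in flatten (map unzip1 B) by apply/flattenP; exists (unzip1 b); rewrite ?map_f.
rewrite /support; elim: (flatten _) => //= s t IH; rewrite in_cons nth_set_nth /=.
by case: eqP => [->|_ /IH].
Qed.

Lemma spanned_support B y r : spanned B y -> ~~ nth false (support B) r -> y r = 0.
Proof.
move=> yB r_supp.
have {r_supp}: forall b, b \in B -> coef b r = Z0 by move=> b; apply: nth_support.
elim: B y yB => [|b B IH] y /=; first by move=> ->.
case=> c yB B0; have := IH _ yB; rewrite /vect B0 ?mem_head //.
have -> : Zrat Z0 = 0 by [].
rewrite mulr0 subr0; apply=> b' b'B; apply: B0; by rewrite in_cons b'B orbT.
Qed.

Lemma equation_relevant env a y c B : compatible env a -> spanned B y ->
  equation a y c -> equation a y (filter (relevant (support B) env) c).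
Proof.
move=> env_a yB; rewrite /equation big_filter => sum0; rewrite big_mkcond -[RHS]sum0.
apply: eq_bigr => e _; case: ifPn => //; rewrite negb_and => /orP[supp|].
  by rewrite (spanned_support yB supp) mulr0.
have := env_a e.2; case: (known env e.2) => // -[] //= -> _.
by have -> : Zrat Z0 = 0 by []; rewrite mul0r.
Qed.

Lemma eval_form env a y c : compatible env a -> usable env c ->
  equation a y c -> eval (form env c) y = 0.
Proof.
move=> env_a; rewrite /equation /eval /form big_map /=.
have vals : all (fun e => is_value (known env e.2)) c ->
    \sum_(e <- c) a e.2 * y e.1 = 0 ->
    \sum_(e <- c) Zrat (if known env e.2 is Value z then z else Zpos xH) * y e.1 = 0.
  move/allP=> c_val sum0; rewrite -[RHS]sum0 big_seq [RHS]big_seq.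
  apply: eq_bigr => e /c_val; have := env_a e.2.
  by case: (known env e.2) => //= z ->.
case: c vals => [|e [|e' c]] vals; rewrite /usable; [exact: vals | | exact: vals].
have := env_a e.2; move: vals; rewrite /= !big_seq1.
case: known => //= _ a_neq0 _ /eqP.
by rewrite mulf_eq0 (negbTE a_neq0) /= => /eqP->; rewrite mulr0.
Qed.

(** [B0] is the family at the start of the pass: the flags are not updated while
    [B] shrinks, which is harmless since [y] stays in the span of [B0]. *)
Lemma sweepP env a y B0 cols B : compatible env a -> spanned B0 y ->
    (forall c, c \in cols -> equation a y c) -> spanned B y ->
  let: (cols', B') := sweep (support B0) env cols B in
  (forall c, c \in cols' -> equation a y c) /\ spanned B' y.
Proof.
move=> env_a yB0; elim: cols B => [|c cols IH] B //= sol yB.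
have sol_c := equation_relevant env_a yB0 (sol c (mem_head _ _)).
have sol' c' : c' \in cols -> equation a y c'.
  by move=> c'_in; apply: sol; rewrite in_cons c'_in orbT.
case: nilP => _; first exact: IH.
case: ifP => [use_c|_].
  by apply: IH sol' _; apply: cutP yB _; apply: eval_form sol_c.
case: sweep (IH B sol' yB) => rest B' [sol_rest yB']; split=> // c'.
by rewrite in_cons => /predU1P[->|/sol_rest].
Qed.

Lemma propagateP n env a y cols B : compatible env a ->
    (forall c, c \in cols -> equation a y c) -> spanned B y ->
  let: (cols', B') := propagate n env cols B in
  (forall c, c \in cols' -> equation a y c) /\ spanned B' y.
Proof.
move=> env_a; elim: n cols B => [|n IH] cols B sol yB /=.
  by have := sweepP env_a yB sol yB; case: sweep.
have := sweepP env_a yB sol yB; case: sweep => cols' B' [sol' yB'].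
by case: ifP => // _; apply: IH.
Qed.

Lemma compatible_unknown n a : compatible (nseq n Unknown) a.
Proof. by move=> k; rewrite /known nth_nseq if_same. Qed.

Lemma compatible_set env a k kn :
  compatible env a -> agrees kn (a k) -> compatible (set_nth Unknown env k kn) a.
Proof.
by move=> env_a ak i; rewrite /known nth_set_nth /=; case: eqP => [->|_] //; apply: env_a.
Qed.

(** The branch that agrees with [a] cannot be closed by a nonzero [y], so it ends
    in a leaf. *)
Lemma searchP (P : seq knowledge -> bool) vars env a y cols B :
    (forall k, a k \in small_values) -> compatible env a ->
    (forall c, c \in cols -> equation a y c) -> spanned B y ->
    search P vars env cols B -> (exists r, y r != 0) ->
  exists2 env', compatible env' a & P env'.
Proof.
move=> a_small + + + + y_neq0; elim: vars env cols B => [|k vars IH] env cols B env_a sol yB /=.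
  by exists env.
case: ifP => _; first exact: IH.
have [n [lt_n a_n]] := refineP (a_small k) (env_a k).
move/all_nthP => /(_ Unknown n lt_n) /=; set env' := set_nth _ _ _ _.
have env'_a : compatible env' a by apply: compatible_set.
have := propagateP (size B) env'_a sol yB; case: propagate => cols' B' [sol' yB'].
case: (@nilP _ B') => [B'0|_]; last exact: IH.
by move: yB' y_neq0; rewrite B'0 => y0 [r]; rewrite y0 eqxx.
Qed.

(** * Comparison with the listed families *)

(** In every family the parameters are entries of the vector itself, so a vector
    belongs to a family only if it is the member whose parameters are read off
    from the entries.  Each candidate comes with the proof that it is listed. *)
Definition families (a : nat -> rat) : seq {t | listed t} :=
  let a2 := a 1%N in let a3 := a 2%N in let a4 := a 3%N in
  let a5 := a 4%N in let a6 := a 5%N in let a7 := a 6%N in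
  let a8 := a 7%N in let a9 := a 8%N in let a10 := a 9%N in
  let fam t (h : listed t) := exist listed t h in
  [:: fam _ pt1; fam _ pt2; fam _ pt3; fam _ pt4; fam _ pt5; fam _ pt6;
   fam _ pt7; fam _ pt8; fam _ pt9;
   fam _ (line1 a2); fam _ (line2 a5); fam _ (line3 a8); fam _ (line4 a4);
   fam _ (line5 a3); fam _ (line6 a4); fam _ (line7 a5); fam _ (line8 a4);
   fam _ (line9 a4); fam _ (line10 a4); fam _ (line11 a7); fam _ (line12 a5);
   fam _ (line13 a7); fam _ (line14 a7); fam _ (line15 a5); fam _ (line16 a5);
   fam _ (line17 a5); fam _ (line18 a5); fam _ (line19 a6); fam _ (line20 a8);
   fam _ (line21 a9); fam _ (line22 a7); fam _ (line23 a7); fam _ (line24 a10);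
   fam _ (line25 a8); fam _ (line26 a10); fam _ (line27 a10);
   fam _ (plane1 a2 a3); fam _ (plane2 a2 a4); fam _ (plane3 a4 a5);
   fam _ (plane4 a5 a10); fam _ (plane5 a6 a8); fam _ (plane6 a9 a10)].

Definition known_rat (kn : knowledge) : rat := if kn is Value z then Zrat z else 0.

(** The first nonzero entry of a listed vector is 1, which determines the scalar.
    The zero vector has to pass: every [y] solves its equations. *)
Definition scaled_listed (s : seq rat) : bool :=
  let c := head 0 [seq x <- s | x != 0] in
  let v := [seq x / c | x <- s] in
  all (fun x => x == 0) s ||
  (c != 0) && has (fun t => v == val (sval t)) (families (nth 0 v)).

Definition env_listed (env : seq knowledge) : bool :=
  [&& size env == 10, all is_value env & scaled_listed (map known_rat env)].

Lemma scaled_listedP (a : 10.-tuple rat) :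
    scaled_listed a -> opoly32 a != 0 ->
  exists2 b : 10.-tuple rat, listed b & op_equiv (opoly32 a) (opoly32 b).
Proof.
rewrite /scaled_listed; set c := head 0 _ => /orP[/allP a0|/andP[c_neq0]].
  case/eqP; rewrite opoly32E.
  have -> : tval a = [seq 0 * x | x <- a].
    rewrite -[LHS]map_id; apply/eq_in_map => x x_a.
    by rewrite mul0r; apply/eqP/a0.
  by rewrite lincombZ scale0r.
case/(has_nthP (exist listed _ pt9)) => n _; case: nth => b b_listed.
move=> /eqP /= eq_b _; exists b => //; exists c => //.
rewrite !opoly32E -lincombZ; congr lincomb; rewrite -eq_b -map_comp -[LHS]map_id.
by apply: eq_map => x /=; rewrite mulrC divfK.
Qed.

Lemma env_listedP (a : 10.-tuple rat) env :
    compatible env (nth 0 a) -> env_listed env -> scaled_listed a.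
Proof.
move=> env_a /and3P[/eqP size_env /all_nthP env_val].
suff -> : map known_rat env = a by [].
apply: (@eq_from_nth _ 0); rewrite size_map size_env ?size_tuple // => k lt_k.
rewrite (nth_map Unknown) ?size_env //; have := env_a k.
have := env_val Unknown k; rewrite size_env => /(_ lt_k).
by rewrite /known; case: nth => //= z _ ->.
Qed.

(** * The equations for the consequences *)

(** The equation attached to the monomial [w]: the pairs of a consequence [r] and an
    index [k] such that [w] carries the coefficient [a_(k+1)] in it. *)
Definition column (w : word) : seq (nat * nat) :=
  [seq e <- [seq (r, k) | r <- iota 0 42, k <- iota 0 10]
     | nth [::] (nth [::] rows e.1) e.2 == w].

Lemma size_nth_rows r : (r < 42)%N -> size (nth [::] rows r) = 10%N.
Proof.
rewrite -size_rows => /(mem_nth [::]) r_row; apply/eqP.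
by have /allP/(_ _ r_row) : all (fun ws => size ws == 10%N) rows by vm_compute.
Qed.

Lemma equation_column (a : 10.-tuple rat) (y : nat -> rat) w :
  \sum_(r < 42) y r * coeff w (lincomb a (nth [::] rows r)) = 0 ->
  equation (nth 0 a) y (column w).
Proof.
move=> sum0; rewrite /equation /column big_filter big_mkcond big_allpairs -[RHS]sum0.
rewrite -(big_mkord xpredT (fun r => y r * coeff w (lincomb a (nth [::] rows r)))).
rewrite /index_iota subn0 !big_seq; apply: eq_bigr => r; rewrite mem_iota /= => lt_r.
rewrite coeff_lincomb size_nth_rows // mulr_sumr /index_iota subn0.
apply: eq_bigr => k _ /=; case: eqP => _; last by rewrite !mulr0.
by rewrite mulr1 mulrC.
Qed.

Lemma nontrivial_relation (a : 10.-tuple rat) :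
    (\rank (conseq_mx 2 (opoly32 a)) < 42)%N ->
  exists y : nat -> rat, [/\ exists r, y r != 0, spanned (unit_vectors 42) y &
    forall c, c \in map column (monomials 5 3) -> equation (nth 0 a) y c].
Proof.
case/relation_of_rank=> v /rV0Pn[r0 v_r0] v_rel.
exists (fun r => if (r < 42)%N then v 0 (inord r) else 0); split.
- by exists r0; rewrite ltn_ord inord_val.
- by apply: spanned_unit_vectors => r le_r; rewrite ltnNge le_r.
- move=> _ /mapP[w /v_rel rel_w ->]; apply: equation_column; rewrite -[RHS]rel_w.
  by apply: eq_bigr => r _; rewrite ltn_ord inord_val.
Qed.

(** An order of the coefficients for which the tree of cases is small. *)
Definition var_order : seq nat := [:: 6; 4; 1; 2; 9; 0; 3; 7; 5; 8]%N.

(** All leaves are listed; the equations start with the full space for [y]. *)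
Lemma search_listed :
  search env_listed (var_order ++ var_order) (nseq 10 Unknown)
    (map column (monomials 5 3)) (unit_vectors 42).
Proof. by vm_cast_no_check (erefl true). Qed.

Theorem theorem5p2 (a : 10.-tuple rat)
    (a_nz : opoly32 a != 0)
    (a_small : forall k : 'I_10, tnth a k \in [:: 0; 1; -1; 2; -2])
    (a_submaximal : (\rank (conseq_mx 2 (opoly32 a))
                     < \rank (conseq_mx 2 (opoly32 generic_coeffs)))%N) :
  exists2 b : 10.-tuple rat, listed b & op_equiv (opoly32 a) (opoly32 b).
Proof.
have [y [y_neq0 y_span y_rel]] :=
  nontrivial_relation (leq_trans a_submaximal (rank_conseq_le generic_coeffs)).
have small k : a`_k \in small_values.
  have [lt_k|le_k] := ltnP k 10; last by rewrite nth_default ?size_tuple.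
  by have := a_small (Ordinal lt_k); rewrite (tnth_nth 0).
have [env env_a env_ok] :=
  searchP small (@compatible_unknown 10 _) y_rel y_span search_listed y_neq0.
exact: scaled_listedP (env_listedP env_a env_ok) a_nz.
Qed.
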